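(* Every finite ČF$T_1$ fuzzy closure space (i.e. every ČF$T_1$ fuzzy closure space $(X,c)$ with $X$ a finite set) is ČF$T_2$.
   Context: $I=[0,1]$; a fuzzy (sub)set of a non-empty set $X$ is a map $f:X\to I$, and $I^X$ is the set of all of them, ordered pointwise, with $\vee,\wedge$ pointwise supremum/infimum. $\underline 0$ is the constant $0$ fuzzy set; the complement is $\mathfrak{Co}(f)(x)=1-f(x)$. For $x\in X$ and $0<\lambda\le1$, the fuzzy point $x_\lambda$ has value $\lambda$ at $x$ and $0$ elsewhere; $x_\lambda\in f$ means $x_\lambda\le f$, i.e. $\lambda\le f(x)$. Fuzzy points $x_\lambda,y_\gamma$ are distinct if $x\ne y$. A fuzzy closure space is a pair $(X,c)$ with $X$ a non-empty set and $c:I^X\to I^X$ satisfying $c(\underline 0)=\underline 0$, $f\le c(f)$, and $c(f\vee g)=c(f)\vee c(g)$ for all $f,g\in I^X$ (idempotency is not required). The interior is $\operatorname{int}(f)=\mathfrak{Co}(c(\mathfrak{Co}(f)))$; $f$ is a neighborhood of a fuzzy point $x_\lambda$ if $x_\lambda\le\operatorname{int}(f)$. $(X,c)$ is ČF$T_1$ if for every two distinct fuzzy points $x_\lambda,y_\gamma$ of $X$, both $x_\lambda\in\mathfrak{Co}(c(y_\gamma))$ and $y_\gamma\in\mathfrak{Co}(c(x_\lambda))$. $(X,c)$ is ČF$T_2$ if for every two distinct fuzzy points $x_\lambda,y_\gamma$ there are neighborhoods $f$ of $x_\lambda$ and $g$ of $y_\gamma$ such that $f\le\mathfrak{Co}(g)$,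 $x_\lambda\in f\le\mathfrak{Co}(y_\gamma)$ and $y_\gamma\in g\le\mathfrak{Co}(x_\lambda)$. *)

(* Defs.v *)
From mathcomp Require Import all_boot all_order all_algebra.
From mathcomp Require Import interval_inference.
From mathcomp Require Import all_classical all_reals.

Set Implicit Arguments.
Unset Strict Implicit.
Unset Printing Implicit Defensive.

Import Order.TTheory GRing.Theory Num.Theory.

Local Open Scope classical_set_scope.
Local Open Scope ring_scope.

(* [(f <= g)%O] and [(f `|` g)%O] on fuzzy sets are the pointwise order and
   the pointwise join that boolp provides for functions into a lattice, here
   the chain {i01 R} = [0, 1]. *)
Definition fuzzy_set (R : realType) (X : Type) : Type := X -> {i01 R}.

Section FuzzyClosure.
Context {R : realType} {X : Type}.
Implicit Types (f g : fuzzy_set R X) (c : fuzzy_set R X -> fuzzy_set R X).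
Implicit Types (x y : X) (l m : {itv R & `]0, 1]}).

Definition fuzzy0 : fuzzy_set R X := fun=> 0%:i01.

Definition fuzzy_compl f : fuzzy_set R X := fun x => (1 - (f x)%:num)%:i01.

(* The fuzzy point x_l; [x_l \in f] means [x_l <= f], so membership is written
   [(fuzzy_point x l <= f)%O]. *)
Definition fuzzy_point x l : fuzzy_set R X :=
  fun z => if `[< z = x >] then l%:num%:i01 else 0%:i01.

Record is_fuzzy_closure_space c : Prop := IsFuzzyClosureSpace {
  fclosure_nonempty : [set: X] !=set0 ;
  fclosure0 : c fuzzy0 = fuzzy0 ;
  fclosure_ext : forall f, (f <= c f)%O ;
  fclosureU : forall f g, c (f `|` g)%O = (c f `|` c g)%O }.

Definition fuzzy_interior c f : fuzzy_set R X :=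
  fuzzy_compl (c (fuzzy_compl f)).

Definition fuzzy_nbhs c x l f : Prop :=
  (fuzzy_point x l <= fuzzy_interior c f)%O.

Definition CFT1 c : Prop := forall x y l m, x <> y ->
  (fuzzy_point x l <= fuzzy_compl (c (fuzzy_point y m)))%O /\
  (fuzzy_point y m <= fuzzy_compl (c (fuzzy_point x l)))%O.

Definition CFT2 c : Prop := forall x y l m, x <> y ->
  exists f g, [/\ fuzzy_nbhs c x l f, fuzzy_nbhs c y m g,
    (f <= fuzzy_compl g)%O,
    (fuzzy_point x l <= f <= fuzzy_compl (fuzzy_point y m))%O &
    (fuzzy_point y m <= g <= fuzzy_compl (fuzzy_point x l))%O].

End FuzzyClosure.

(* Main.v *)
Require Import Defs.
From mathcomp Require Import all_boot all_order all_algebra.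
From mathcomp Require Import interval_inference.
From mathcomp Require Import all_classical all_reals.

(** Testing ČFT1 on points of height 1 shows that [c] of a fuzzy point
    vanishes off its support. By additivity and finiteness, [c f] vanishes
    wherever [f] does. Hence the crisp points [x_1] and [y_1] are open, and they
    separate [x_l] from [y_m]. *)

Local Open Scope classical_set_scope.

Import Order.TTheory GRing.Theory Num.Theory.
Local Open Scope ring_scope.

Section FuzzyClosureTheory.
Context {R : realType} {X : choiceType}.
Implicit Types (f g : fuzzy_set R X) (x y : X) (l m : {itv R & `]0, 1]}).
Variable c : fuzzy_set R X -> fuzzy_set R X.

Lemma fuzzy_leP f g :
  reflect (forall x, (f x)%:num <= (g x)%:num) (f <= g)%O.
Proof. by apply: (iffP (lefP _ _)) => h x; move: (h x); rewrite -num_le. Qed.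

Lemma num_fuzzy_compl f x : (fuzzy_compl f x)%:num = 1 - (f x)%:num.
Proof. by []. Qed.

Lemma num_fuzzy_point x l z :
  (fuzzy_point x l z)%:num = if z == x then l%:num else 0.
Proof.
rewrite /fuzzy_point; case: eqP => [->|zx]; first by rewrite asboolT.
by rewrite asboolF.
Qed.

(** The indicator function of {x}; [widen_itv] enlarges the interval inferred for 1 to []0, 1]], the
    range of heights. *)
Definition crisp_point x : fuzzy_set R X := fuzzy_point x (widen_itv 1%:itv).

Lemma num_crisp_point x z : (crisp_point x z)%:num = if z == x then 1 else 0.
Proof. by rewrite num_fuzzy_point. Qed.

Lemma i01_ge0 (a : {i01 R}) : 0 <= a%:num.
Proof. by []. Qed.

Lemma i01_le1 (a : {i01 R}) : a%:num <= 1.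
Proof. by []. Qed.

Hypothesis cX : is_fuzzy_closure_space c.

Lemma fclosure_le f g : (f <= g)%O -> (c f <= c g)%O.
Proof.
by move=> /join_idPl fg; apply/join_idPl; rewrite -(fclosureU cX) fg.
Qed.

Hypothesis c1 : CFT1 c.

Lemma fclosure_point_eq0 x y m : x <> y -> (c (fuzzy_point y m) x)%:num = 0.
Proof.
(* With height 1 at [x], the inequality at [x] reads 1 <= 1 - c(y_m)(x). *)
move=> xy; have [/fuzzy_leP/(_ x) + _] := c1 x y (widen_itv 1%:itv) m xy.
rewrite num_fuzzy_point eqxx num_fuzzy_compl /= lerBrDr gerDl => h.
by apply/eqP; rewrite eq_le h i01_ge0.
Qed.

(** Induction on a list containing the support of [f], peeling off one point at a time; [f] varies
    while [x] stays fixed. *)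
Lemma fclosure_eq0_seq (s : seq X) f x :
  (forall z, (f z)%:num != 0 -> z \in s) ->
  (f x)%:num = 0 -> (c f x)%:num = 0.
Proof.
elim: s f => [|y s IHs] f fs fx0.
  have -> : f = fuzzy0.
    by apply/funext => z; apply/val_inj/eqP; apply: contraT => /fs.
  by rewrite (fclosure0 cX).
(* If [y] is [x], then [f] vanishes at [y], so the tail already contains the support. *)
have [yx|/eqP xy] := eqVneq x y.
  apply: IHs => // z fz; have := fs _ fz; rewrite inE => /orP[/eqP zy|//].
  by move: fz; rewrite zy -yx fx0 eqxx.
(* Erase the value of [f] at [y]. Bounding that value by 1 avoids a fuzzy point of height [f y],
   which may be 0. *)
pose g : fuzzy_set R X := fun z => if z == y then fuzzy0 z else f z.
have gx : (c g x)%:num = 0.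
  apply: IHs; last by rewrite /g; case: eqP.
  move=> z; rewrite /g; case: ifPn => [_|zy /fs]; first by rewrite eqxx.
  by rewrite inE (negPf zy).
have fg : (f <= g `|` crisp_point y)%O.
  apply/fuzzy_leP => z; rewrite joinfE joinEtotal num_max le_max.
  by rewrite num_crisp_point /g; case: (z == y); rewrite ?i01_le1 ?lexx ?orbT.
have /fuzzy_leP/(_ x) := fclosure_le _ _ fg.
rewrite (fclosureU cX) joinfE joinEtotal num_max gx fclosure_point_eq0//.
by rewrite maxxx => h; apply/eqP; rewrite eq_le h i01_ge0.
Qed.

Hypothesis finX : finite_set [set: X].

Lemma fclosure_eq0 f x : (f x)%:num = 0 -> (c f x)%:num = 0.
Proof.
have /finite_seqP[s sE] := finX.
apply: (fclosure_eq0_seq s) => z _.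
by have : [set` s] z by rewrite -sE.
Qed.

(** The complement of [crisp_point x] vanishes at [x], hence so does its closure, and the interior
    has value 1 there. *)
Lemma fuzzy_nbhs_point x l : fuzzy_nbhs c x l (crisp_point x).
Proof.
apply/fuzzy_leP => z; rewrite num_fuzzy_point.
case: eqP => [->|_]; last exact: i01_ge0.
rewrite /fuzzy_interior num_fuzzy_compl fclosure_eq0 ?subr0//.
by rewrite num_fuzzy_compl num_crisp_point eqxx subrr.
Qed.

Lemma fuzzy_point_le x l : (fuzzy_point x l <= crisp_point x)%O.
Proof. by apply/fuzzy_leP => z; rewrite num_fuzzy_point num_crisp_point; case: eqP. Qed.

Lemma fuzzy_point_le_compl x y l m :
  x <> y -> (fuzzy_point x l <= fuzzy_compl (fuzzy_point y m))%O.
Proof.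
move=> xy; apply/fuzzy_leP => z; rewrite num_fuzzy_compl !num_fuzzy_point.
case: eqP => [->|_]; first by move/eqP/negPf: xy => ->; rewrite subr0.
by rewrite subr_ge0; case: eqP.
Qed.

Lemma finite_CFT2 : CFT2 c.
Proof.
move=> x y l m xy; have yx : y <> x by move/esym.
exists (crisp_point x), (crisp_point y); split.
- exact: fuzzy_nbhs_point.
- exact: fuzzy_nbhs_point.
(* Both heights are 1 here: the supports are disjoint, so the heights do not matter. *)
- exact: fuzzy_point_le_compl.
- by rewrite fuzzy_point_le fuzzy_point_le_compl.
- by rewrite fuzzy_point_le fuzzy_point_le_compl.
Qed.

End FuzzyClosureTheory.

Local Close Scope ring_scope.

Theorem theorem6p3 (R : realType) (X : Type)
    (c : fuzzy_set R X -> fuzzy_set R X) :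
  is_fuzzy_closure_space c -> finite_set [set: X] -> CFT1 c -> CFT2 c.
Proof.
(* [Pchoice] equips the arbitrary type [X] with a classical choice structure, which supplies the
   [==] and list membership used above. *)
by elim/Pchoice: X => X in c *; move=> cX finX c1; exact: finite_CFT2.
Qed.
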